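(* Let $n \ge 1$. A signed permutation $w \in S^{\mathrm{B}}_n$ is boolean (as an element of the type-B Coxeter group $S^{\mathrm{B}}_n$) if and only if $w$ globally avoids the patterns $321$ and $3412$. In other words, being boolean is a persistent property.
   Context: Notation: $[n]=\{1,\dots,n\}$ and $[\pm n]=\{\pm1,\dots,\pm n\}$. Elements of the symmetric group $S_k$ are written in one-line notation $p(1)\cdots p(k)$. A signed permutation of size $n$ is a bijection $w:[\pm n]\to[\pm n]$ with $w(-x)=-w(x)$ for all $x\in[n]$. The group of these under composition is $S^{\mathrm{B}}_n$, the finite Coxeter group of type B, with simple generators $s_0,s_1,\dots,s_{n-1}$, where $s_0$ exchanges $1$ and $-1$ and fixes all other elements of $[\pm n]$, and, for $1\le i\le n-1$, $s_i$ exchanges $i$ with $i+1$ and $-i$ with $-(i+1)$ and fixes all other elements. The symmetric group $S_n$ is the Coxeter group of type A, with the adjacent transpositions as simple generators. Boolean: an element $w$ of a Coxeter group $G$ is boolean if the principal order ideal of $w$ in the Bruhat order on $G$ is isomorphic to a boolean lattice. Classical avoidance in $S_n$: for $p\in S_k$, a permutation $w\in S_n$ contains $p$ if there are indices $1\le i_1<\cdots<i_k\le n$ such that $w(i_1)\cdots w(i_k)$ is order-isomorphic to $p$; otherwise $w$ avoids $p$. Global avoidance: for $p\in S_k$, a signed permutation $w\in S^{\mathrm{B}}_n$ globally contains $p$ if there are indices $i_1<\cdots<i_k$ in $[\pm n]$ (in the usual order of the integers) such that $w(i_1)\cdots w(i_k)$ is order-isomorphic to $p$; otherwise $w$ globally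 avoids $p$. Persistent: let $\phi$ be a property defined for elements of $S_n$ and of $S^{\mathrm{B}}_n$ such that the permutations in $S_n$ with property $\phi$ are exactly those avoiding all patterns in a set $A_\phi$ of (unsigned) permutations. The property $\phi$ is persistent if the signed permutations in $S^{\mathrm{B}}_n$ with property $\phi$ are exactly those globally avoiding all patterns in $A_\phi$. It is a known result that a permutation in $S_n$ is boolean if and only if it avoids $321$ and $3412$. *)

(* Defs.v *)
From mathcomp Require Import all_boot all_order all_algebra all_fingroup.

Set Implicit Arguments.
Unset Strict Implicit.
Unset Printing Implicit Defensive.

Import Order.TTheory GRing.Theory Num.Theory GroupScope.

(* Finite Coxeter groups, given as a group [G] inside a finite group type
   together with the set [S] of its simple generators. *)
Section Coxeter.
Variables (gT : finGroupType) (G S : {set gT}).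

(* [S ^+ k] is the set of products of [k] elements of [S].  Every element of
   the group generated by [S] is a product of fewer than [#|gT|] generators,
   so the bounded search finds the length; see [cox_lengthP]. *)
Definition cox_length (w : gT) : nat :=
  find (fun k => w \in S ^+ k) (iota 0 #|gT|).

(* Permutations compose from left to right here, [(u * v) x = v (u x)].  The
   reflections are closed under conjugation and inversion preserves length, so
   neither this nor multiplying by [t] on the right affects the Bruhat order. *)
Definition reflections : {set gT} := class_support S G.

Definition bruhat_step : rel gT := fun u v =>
  [exists t in reflections, v == u * t] && (cox_length u < cox_length v).

Definition bruhat_le : rel gT := connect bruhat_step.

Definition principal_ideal (w : gT) : {set gT} :=
  [set u in G | bruhat_le u w].

(* The boolean lattice of rank [r] is the set of subsets of ['I_r], ordered by
   inclusion. *)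
Definition boolean (w : gT) : Prop :=
  exists (r : nat) (f : gT -> {set 'I_r}),
    [/\ {in principal_ideal w &, injective f},
        f @: principal_ideal w = [set: {set 'I_r}]
      & {in principal_ideal w &,
          forall u v, bruhat_le u v = (f u \subset f v)}].

End Coxeter.

Lemma expg_set_prod (gT : finGroupType) (S : {set gT}) k w :
  w \in S ^+ k <->
  exists s : seq gT, [/\ size s = k, {subset s <= S} & w = \prod_(x <- s) x].
Proof.
elim: k w => [|k IHk] w.
  rewrite expg0; split=> [/set1P-> | [s [/size0nil-> _ ->]]].
    by exists [::]; rewrite big_nil.
  by rewrite big_nil set11.
rewrite expgS; split=> [/mulsgP[x y Sx /IHk[s [<- sS ->]] ->] | ].
  exists (x :: s); rewrite big_cons; split=> // z.
  by rewrite inE => /predU1P[->|/sS].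
case=> [[|x s] []] //= [sz] sS ->; rewrite big_cons; apply: mem_mulg.
  by rewrite sS ?mem_head.
by apply/IHk; exists s; split=> // z zs; rewrite sS ?inE ?zs ?orbT.
Qed.

(* A shortest word has pairwise distinct prefix products. *)
Lemma cox_lengthP (gT : finGroupType) (S : {set gT}) w :
  w \in <<S>> ->
  w \in S ^+ cox_length S w /\
  forall k, w \in S ^+ k -> cox_length S w <= k.
Proof.
move=> Sw.
have exk : exists k, w \in S ^+ k.
  have /gen_prodgP[k [c Sc ->]] := Sw; exists k; apply/expg_set_prod.
  exists [seq c i | i <- enum 'I_k]; rewrite big_map [index_enum _]unlock enumT; split=> //.
    by rewrite size_map -enumT size_enum_ord.
  by move=> _ /mapP[i _ ->].
have [m Sm min_m] := ex_minnP exk.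
have lt_m : m < #|gT|.
  have [s [sz sS def_w]] := (expg_set_prod S m w).1 Sm.
  pose P (i : 'I_m.+1) := \prod_(x <- take i s) x.
  have injP : injective P.
    suff lt_neq (i j : 'I_m.+1) : i < j -> P i != P j.
      move=> i j eqP; apply/val_inj; case: (ltngtP i j) => // /lt_neq.
        by rewrite eqP eqxx.
      by rewrite eqP eqxx.
    move=> lt_ij; apply/eqP=> eqP.
    have : w \in S ^+ (i + (m - j)).
      apply/expg_set_prod; exists (take i s ++ drop j s); split.
      - rewrite size_cat size_take size_drop sz; case: ltnP => // le_mi.
        by have := leq_trans lt_ij (ltn_ord j : j <= m); rewrite ltnNge le_mi.
      - by move=> x; rewrite mem_cat => /orP[/mem_take|/mem_drop]; apply: sS.
      rewrite def_w -{1}(cat_take_drop j s) !big_cat /=.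
      by rewrite -/(P j) -eqP.
    move=> /min_m; rewrite leqNgt => /negP; apply.
    apply: (@leq_trans (j + (m - j))); first by rewrite ltn_add2r.
    by rewrite subnKC ?leq_ord.
  by have := leq_card _ injP; rewrite card_ord.
suff -> : cox_length S w = m by [].
have has_m : has (fun k => w \in S ^+ k) (iota 0 #|gT|).
  by apply/hasP; exists m; rewrite ?mem_iota.
apply/eqP; rewrite eqn_leq; apply/andP; split.
  rewrite leqNgt; apply/negP=> /(before_find 0%N).
  by rewrite nth_iota // add0n Sm.
have := nth_find 0%N has_m; rewrite -/(cox_length S w) nth_iota ?add0n.
  exact: min_m.
by move: has_m; rewrite has_find size_iota.
Qed.

(* Type A: ['S_n], acting on [0 .. n-1] instead of [1 .. n]. *)
Definition gensA n : {set 'S_n} :=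
  [set tperm i j | i in 'I_n, j in 'I_n & i.+1 == j :> nat].

Definition booleanA n (w : 'S_n) : Prop := boolean [set: 'S_n] (gensA n) w.

(* Type B: the pair [(b, i)] stands for [i + 1] if [b] is false and for
   [- (i + 1)] if [b] is true. *)
Notation pm n := (bool * 'I_n)%type.

Definition pmval n (x : pm n) : int := ((-1) ^+ x.1 * (x.2.+1)%:Z)%R.

Definition pmopp n (x : pm n) : pm n := (~~ x.1, x.2).

Lemma pmval_opp n (x : pm n) : pmval (pmopp x) = (- pmval x)%R.
Proof. by case: x => [[] i]; rewrite /pmval /= ?mulN1r ?mul1r ?opprK. Qed.

Lemma pmval_image n (z : int) :
  (exists x : pm n, pmval x = z) <-> (0 < `|z| <= n)%N.
Proof.
split=> [[[b i] <-] | /andP[z_gt0 le_zn]].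
  by rewrite /pmval abszM abszX exp1n mul1n ltn_ord.
have lt_z : (`|z|.-1 < n)%N by rewrite prednK.
exists ((z < 0)%R, Ordinal lt_z); rewrite /pmval /= prednK //.
by rewrite -intEsign.
Qed.

Definition signed_perm n : {set {perm (pm n)}} :=
  [set w : {perm (pm n)} | [forall x, w (pmopp x) == pmopp (w x)]].

Lemma signed_perm_group_set n : group_set (signed_perm n).
Proof.
apply/group_setP; split=> [|u v].
  by rewrite inE; apply/forallP=> x; rewrite !perm1.
rewrite !inE => /forallP u_opp /forallP v_opp; apply/forallP=> x.
by rewrite !permM (eqP (u_opp x)) v_opp.
Qed.
Canonical signed_perm_group n := Group (signed_perm_group_set n).

Definition gensB n : {set {perm (pm n)}} :=
  [set tperm (false, i) (true, i) | i : 'I_n & i == 0 :> nat]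
  :|: [set tperm (false, i) (false, j)
           * tperm (true, i) (true, j)
      | i in 'I_n, j in 'I_n & i.+1 == j :> nat].

Definition booleanB n (w : {perm (pm n)}) : Prop :=
  boolean (signed_perm n) (gensB n) w.

Definition contains k (p : 'S_k) n (w : 'S_n) : Prop :=
  exists2 i : 'I_k -> 'I_n,
    forall a b : 'I_k, a < b -> i a < i b
  & forall a b : 'I_k, (w (i a) < w (i b)) = (p a < p b).

Definition avoids k (p : 'S_k) n (w : 'S_n) : Prop := ~ contains p w.

Definition globally_contains k (p : 'S_k) n (w : {perm (pm n)}) : Prop :=
  exists2 i : 'I_k -> pm n,
    forall a b : 'I_k, a < b -> (pmval (i a) < pmval (i b))%R
  & forall a b : 'I_k, (pmval (w (i a)) < pmval (w (i b)))%R = (p a < p b).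

Definition globally_avoids k (p : 'S_k) n (w : {perm (pm n)}) : Prop :=
  ~ globally_contains p w.

Definition pattern_set := forall k, 'S_k -> Prop.

(* [A] is the set of patterns characterizing the property in type A. *)
Definition persistent (A : pattern_set)
    (phiA : forall n, 'S_n -> Prop) (phiB : forall n, {perm (pm n)} -> Prop) :
    Prop :=
  (forall n (w : 'S_n), 0 < n ->
     (phiA n w <-> forall k (p : 'S_k), A k p -> avoids p w))
  /\ (forall n (w : {perm (pm n)}), 0 < n -> w \in signed_perm n ->
     (phiB n w <-> forall k (p : 'S_k), A k p -> globally_avoids p w)).

Definition one_line k (p : 'S_k) : seq nat := [seq (p i).+1 | i <- enum 'I_k].

Definition p321 : 'S_3 := tperm (@Ordinal 3 0 isT) (@Ordinal 3 2 isT).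
Definition p3412 : 'S_4 :=
  tperm (@Ordinal 4 0 isT) (@Ordinal 4 2 isT)
  * tperm (@Ordinal 4 1 isT) (@Ordinal 4 3 isT).

Lemma one_line_p321 : one_line p321 = [:: 3; 2; 1]%N.
Proof. by rewrite /one_line !enum_ordSl enum_ord0 /= !permE. Qed.

Lemma one_line_p3412 : one_line p3412 = [:: 3; 4; 1; 2]%N.
Proof. by rewrite /one_line !enum_ordSl enum_ord0 /= !permM !permE. Qed.

Inductive boolean_patterns : pattern_set :=
| pattern_321 : boolean_patterns p321
| pattern_3412 : boolean_patterns p3412.

(* Main.v *)
Require Import Defs.
From mathcomp Require Import all_boot all_order all_algebra all_fingroup zify.

(* Both groups consist of permutations of a finite chain commuting with a map
   [theta] (the identity in type A, negation in type B), and every simple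
   generator swaps adjacent elements of the chain, along one [theta]-orbit of
   pairs.  Boolean elements are exactly the products of distinct generators.
   If [w] is boolean of rank [r], the prefixes of a reduced word form a chain in
   its ideal, so its length is at most [r], while the [r] atoms are letters of
   that word, so no letter is repeated.  Conversely, each cut of the chain is
   crossed by a single generator, so in a product of distinct generators the
   cuts that are crossed determine the letters; by strong exchange the ideal is
   the lattice of subwords.  Finally, in a product of distinct generators at
   most one element crosses each cut upwards and no fixed point is jumped over,
   which excludes 321 and 3412.  If [w] avoids both patterns, undoing a descent
   [s] gives an avoiding element that respects the cuts at [s], and hence by
   induction a product of distinct generators other than [s]. *)

Set Implicit Arguments.
Unset Strict Implicit.
Unset Printing Implicit Defensive.

Section AdjacentSwaps.
Import Order.TTheory GRing.Theory Num.Theory GroupScope.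

(* [v] lists the chain [T] by consecutive integers; [e] records whether [theta]
   reverses the order. *)
Variables (T : finType) (v : T -> int) (theta : T -> T) (e : bool).
Variables (G : {group {perm T}}) (S : {set {perm T}}).

Hypothesis v_inj : injective v.
Hypothesis v_gap : forall x y, (v x < v y)%R -> exists z, v z = (v x + 1)%R.
Hypothesis theta_lt : forall x y,
  x != y -> (v (theta x) < v (theta y))%R = (v x < v y)%R (+) e.
Hypothesis G_theta : forall w x, w \in G -> w (theta x) = theta (w x).
Hypothesis SG : S \subset G.
Hypothesis S_inv : forall s x, s \in S -> s (s x) = x.
Hypothesis S_step : forall s x, s \in S -> (v (s x) <= v x + 1)%R.
Hypothesis S_orbit : forall s x y, s \in S -> s x != x -> s y != y ->
  y \in [:: x; s x; theta x; theta (s x)].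
Hypothesis S_moves : forall s, s \in S -> exists x, s x != x.
Hypothesis S_gap : forall x y, v y = (v x + 1)%R -> exists2 s, s \in S & s x = y.

(** * Action of the generators on the chain *)

Lemma v_eq x y : (x == y) = (v x == v y).
Proof. by rewrite (inj_eq v_inj). Qed.

Lemma perm_v_eq (w : {perm T}) x y : (v (w x) == v (w y)) = (v x == v y).
Proof. by rewrite -!v_eq (inj_eq perm_inj). Qed.

Lemma gen_in_G s : s \in S -> s \in G.
Proof. exact: (subsetP SG). Qed.

Lemma gen_mulK s (w : {perm T}) : s \in S -> s * (s * w) = w.
Proof. by move=> Ss; apply/permP=> x; rewrite !permM S_inv. Qed.

Lemma prod_in_G W : {subset W <= S} -> \prod_(x <- W) x \in G.
Proof.
by move=> WS; rewrite big_seq; apply: group_prod => s /WS; apply: gen_in_G.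
Qed.

(** An involution moving each element by at most one place can reverse only a pair that it swaps. *)
Lemma gen_lt s x y : s \in S -> (v x < v y)%R -> y != s x -> (v (s x) < v (s y))%R.
Proof.
move=> Ss; rewrite v_eq => lt_xy ne_y.
have := S_step x Ss; have := S_step y Ss.
have := S_step (s x) Ss; have := S_step (s y) Ss; rewrite !S_inv //.
have := perm_v_eq s x y; have := perm_v_eq s (s x) y; rewrite S_inv //.
lia.
Qed.

Lemma gen_moves_up s : s \in S -> exists x, (v x < v (s x))%R.
Proof.
move=> Ss; have [x] := S_moves Ss; rewrite v_eq => ne_x.
have [lt_x|le_x] := boolP (v x < v (s x))%R; first by exists x.
by exists (s x); rewrite S_inv //; lia.
Qed.

(** * Reflections and the exchange property *)

(** The properties of a generator that survive conjugation by [G] and still determine the element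
    from one moved point ([reflection_eq]). *)
Definition reflection (t : {perm T}) :=
  [/\ t \in G, forall x, t (t x) = x, exists x, t x != x
    & forall x y, t x != x -> t y != y ->
        y \in [:: x; t x; theta x; theta (t x)]].

Lemma gen_reflection s : s \in S -> reflection s.
Proof.
move=> Ss; split; [exact: gen_in_G | | exact: S_moves |].
  by move=> x; apply: S_inv.
by move=> x y; apply: S_orbit.
Qed.

Lemma reflectionJ t g : g \in G -> reflection t -> reflection (t ^ g).
Proof.
move=> Gg [Gt tK [x0 ne0] orb].
have tJ x : (t ^ g) x = g (t (g^-1 x)) by rewrite conjgE !permM.
have mv x : (t ^ g) x != x -> t (g^-1 x) != g^-1 x.
  by rewrite tJ -{2}(permKV g x) (inj_eq perm_inj).
split; first by rewrite groupJ.
- by move=> x; rewrite !tJ permK tK permKV.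
- by exists (g x0); rewrite tJ permK (inj_eq perm_inj).
move=> x y /mv ne_x /mv ne_y; have := orb _ _ ne_x ne_y.
rewrite -(permKV g y) permK !inE => /or4P[] /eqP->;
  by rewrite ?G_theta // ?permKV ?tJ eqxx ?orbT.
Qed.

Lemma reflectionsP t : t \in reflections G S -> reflection t.
Proof. by case/imset2P=> s g Ss Gg ->; apply: reflectionJ (gen_reflection Ss). Qed.

Lemma reflection_eq s t x :
  reflection s -> reflection t -> t x = s x -> t x != x -> s = t.
Proof.
move=> [Gs sK _ s_orb] [Gt tK _ t_orb] eq_x ne_x.
have agree y : y \in [:: x; t x; theta x; theta (t x)] -> s y = t y.
  rewrite !inE => /or4P[] /eqP->; first by [].
  - by rewrite tK eq_x sK.
  - by rewrite !G_theta // eq_x.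
  - by rewrite !G_theta // tK eq_x sK.
apply/permP=> y; have [ty|ne_y] := eqVneq (t y) y; last exact: agree (t_orb _ _ _ _).
have [sy|ne_y] := eqVneq (s y) y; first by rewrite ty sy.
by apply: agree; rewrite eq_x; apply: s_orb; rewrite -?eq_x.
Qed.

Lemma gen_eq s t x : s \in S -> t \in S -> s x != x -> t x = s x -> s = t.
Proof.
move=> /gen_reflection Rs /gen_reflection Rt ne_x eq_x.
by apply: (reflection_eq Rs Rt eq_x); rewrite eq_x.
Qed.

Definition flips (w : {perm T}) x y := (v (w x) < v (w y))%R (+) (v x < v y)%R.

(** Some letter of the word must reverse the pair [x], [t x], carried along by the letters before
    it. A letter reverses only a pair that it swaps, so it equals [t] conjugated by those letters,
    and multiplying by [t] cancels it. *)
Lemma exchange W t x : {subset W <= S} -> reflection t -> t x != x ->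
    flips (\prod_(s <- W) s) x (t x) ->
  exists2 i, i < size W &
    t * \prod_(s <- W) s = \prod_(s <- take i W ++ drop i.+1 W) s.
Proof.
elim: W t x => [|s W IH] t x WS Rt ne_x.
  by rewrite big_nil /flips !perm1 addbb.
have Ss : s \in S by apply: WS; rewrite mem_head.
have {}WS : {subset W <= S} by move=> z zW; apply: WS; rewrite inE zW orbT.
have [tK sK] : (forall x, t (t x) = x) /\ (forall x, s (s x) = x).
  by split; [case: Rt | move=> z; apply: S_inv].
rewrite big_cons /flips !permM => flip_w.
have [flip_s|noflip_s] := boolP (flips s x (t x)).
  exists 0 => //=; rewrite drop0.
  suff eq_t : s = t by rewrite -eq_t gen_mulK.
  apply: (reflection_eq (x := x)) => //; first exact: gen_reflection.
  apply/eqP; apply: contraLR flip_s => ne_t; rewrite /flips.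
  have [lt_x|] := boolP (v x < v (t x))%R.
    by rewrite (gen_lt Ss lt_x ne_t).
  rewrite v_eq in ne_x => le_x; have lt_x : (v (t x) < v x)%R by lia.
  have := gen_lt Ss lt_x; rewrite -(inj_eq (@perm_inj _ s)) sK eq_sym => /(_ ne_t).
  lia.
(* [s] keeps the order of the pair, so the rest of the word reverses its image under [s], which
   [t ^ s] swaps. *)
have ne_sx : (t ^ s) (s x) != s x.
  by rewrite conjgE !permM permK (inj_eq perm_inj).
have tJ : (t ^ s) (s x) = s (t x) by rewrite conjgE !permM permK.
have [|||i lt_i def_i] := IH (t ^ s) (s x) WS; first exact: reflectionJ (gen_in_G Ss) Rt.
- exact: ne_sx.
- rewrite tJ; move: noflip_s flip_w; rewrite /flips.
  by do 3!case: (_ < _)%R.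
exists i.+1 => //=; rewrite big_cons -def_i conjgE !mulgA.
by rewrite mulgV mul1g.
Qed.

Lemma subseq_omit (A : eqType) i (W : seq A) : subseq (take i W ++ drop i.+1 W) W.
Proof.
rewrite -{3}(cat_take_drop i W) subseq_cat2l -addn1 addnC -drop_drop.
exact: drop_subseq.
Qed.

Lemma size_omit (A : eqType) i (W : seq A) :
  i < size W -> size (take i W ++ drop i.+1 W) < size W.
Proof. by move=> lt_i; rewrite size_cat size_drop size_takel; lia. Qed.

(** * Inversions, descents and generation *)

Local Notation len := (cox_length S).

Definition inversions (w : {perm T}) : {set T * T} :=
  [set p | (v p.1 < v p.2)%R && (v (w p.2) < v (w p.1))%R].

(** The pairs swapped by [s] form one [theta]-orbit; [w] commutes with [theta], which acts on the
    order of positions and of values alike. *)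
Lemma gen_flips_all s w x y : s \in S -> w \in G ->
    (v x < v (s x))%R -> (v (w (s x)) < v (w x))%R ->
    (v y < v (s y))%R -> (v (w (s y)) < v (w y))%R.
Proof.
move=> Ss Gw lt_x lt_wx lt_y.
have ne_x : s x != x by rewrite v_eq; lia.
have ne_y : s y != y by rewrite v_eq; lia.
have Gs := gen_in_G Ss.
have := S_orbit Ss ne_x ne_y; rewrite !inE => /or4P[] /eqP def_y.
- by rewrite def_y.
- by move: lt_y; rewrite def_y S_inv //; lia.
- move: lt_y; rewrite def_y !G_theta //.
  rewrite !theta_lt ?(inj_eq perm_inj) // 1?eq_sym //.
  lia.
- move: lt_y; rewrite def_y !G_theta // !S_inv //.
  rewrite !theta_lt ?(inj_eq perm_inj) // 1?eq_sym //.
  lia.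
Qed.

(** Applying [s] to both entries injects the inversions of [s * w] into those of [w] and misses
    [(x, s x)]. *)
Lemma inversions_gen s w x : s \in S -> w \in G ->
    (v x < v (s x))%R -> (v (w (s x)) < v (w x))%R ->
  #|inversions (s * w)| < #|inversions w|.
Proof.
move=> Ss Gw lt_x lt_wx.
pose f (p : T * T) := (s p.1, s p.2).
have f_inj : injective f.
  by move=> [a b] [c d] [/perm_inj-> /perm_inj->].
rewrite -(card_imset _ f_inj); apply/proper_card/properP; split.
  apply/subsetP=> _ /imsetP[[a b] + ->]; rewrite !inE /f /= !permM.
  case/andP=> lt_ab lt_w; rewrite lt_w andbT; apply: gen_lt => //.
  apply: contraL lt_w => /eqP def_b; move: lt_ab; rewrite def_b => lt_ab.
  have := gen_flips_all Ss Gw lt_x lt_wx lt_ab; rewrite S_inv //; lia.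
exists (x, s x); first by rewrite inE /= lt_x lt_wx.
apply/negP=> /imsetP[[a b]]; rewrite inE /= => /andP[lt_ab _] [def_a def_b].
move: lt_ab; rewrite (perm_inj (esym def_b)) def_a S_inv // in lt_x *; lia.
Qed.

(** Without descents [w] is increasing on neighbours, hence on the chain, and an increasing
    permutation of a finite chain is the identity. *)
Lemma exists_descent (w : {perm T}) : w != 1 ->
  exists s x, [/\ s \in S, (v x < v (s x))%R & (v (w (s x)) < v (w x))%R].
Proof.
move=> w_neq1; have [/exists_inP[s Ss /existsP[x /andP[lt_x lt_w]]]|no_desc] :=
  boolP [exists s in S, [exists x, (v x < v (s x)) && (v (w (s x)) < v (w x))]]%R.
  by exists s, x.
have w_adj x y : v y = (v x + 1)%R -> (v (w x) < v (w y))%R.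
  move=> def_y; have [s Ss sx] := S_gap def_y.
  have := perm_v_eq w x y; rewrite ltNge le_eqVlt negb_or eq_sym => ->.
  rewrite def_y; apply/andP; split; first by lia.
  apply: contra no_desc => lt_w; apply/exists_inP; exists s => //.
  by apply/existsP; exists x; rewrite sx lt_w def_y; lia.
have w_mono x y : (v x < v y)%R -> (v (w x) < v (w y))%R.
  have [d] := ubnP `|(v y - v x)%R|%N; elim: d x => // d IHd x le_d lt_xy.
  have [z def_z] := v_gap lt_xy; have lt_w := w_adj _ _ def_z.
  have [lt_zy|le_yz] := boolP (v z < v y)%R.
    by apply: lt_trans lt_w _; apply: IHd => //; lia.
  by rewrite (v_inj (x1 := y) (x2 := z)) //; lia.
have [x0 ne_x0] : exists x, w x != x.
  apply/existsP; apply: contraR w_neq1; rewrite negb_exists => /forallP w_fix.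
  by apply/eqP/permP=> x; rewrite perm1; apply/eqP; have := w_fix x; rewrite negbK.
(* For the least moved [x], the moved element [w^-1 x] lies above [x], so monotonicity puts [w x],
   also moved, below [x]. *)
case: (@arg_minP _ _ _ x0 (fun x => w x != x) v ne_x0) => x ne_x x_min.
have ne_z : w (w^-1 x) != w^-1 x by rewrite permKV -(inj_eq (@perm_inj _ w)) permKV.
have le_xz := x_min _ ne_z.
have ne_xz : v (w^-1 x) != v x by rewrite -v_eq -(inj_eq (@perm_inj _ w)) permKV eq_sym.
have lt_wx : (v (w x) < v x)%R.
  by rewrite -{2}(permKV w x); apply: w_mono; lia.
have := x_min (w x); rewrite (inj_eq perm_inj) => /(_ ne_x); lia.
Qed.

Lemma group_generated : G = <<S>> :> {set _}.
Proof.
apply/eqP; rewrite eqEsubset gen_subG SG andbT; apply/subsetP=> w.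
have [d] := ubnP #|inversions w|; elim: d w => // d IHd w le_d Gw.
have [->|/exists_descent[s [x [Ss lt_x lt_w]]]] := eqVneq w 1; first exact: group1.
rewrite -(gen_mulK w Ss) groupM ?(mem_gen Ss) //; apply: IHd.
  by have := inversions_gen Ss Gw lt_x lt_w; lia.
by rewrite groupM ?(gen_in_G Ss).
Qed.

(** * Words, length and the Bruhat order *)

Definition word_of w W := {subset W <= S} /\ w = \prod_(s <- W) s.

Lemma len_le w W : word_of w W -> len w <= size W.
Proof.
case=> WS def_w; have Gw : w \in <<S>> by rewrite -group_generated def_w prod_in_G.
by have [_] := cox_lengthP Gw; apply; apply/expg_set_prod; exists W.
Qed.

Lemma reduced_word w : w \in G -> exists2 W, word_of w W & size W = len w.
Proof.
rewrite group_generated => /cox_lengthP[/expg_set_prod[W [szW WS def_w]] _].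
by exists W.
Qed.

(** If [w] did not reverse the pair swapped by [t], then [t * w] would, and [exchange] on a reduced
    word of [t * w] would make [w] the shorter of the two. *)
Lemma strong_exchange t w W : reflection t -> w \in G -> word_of w W ->
    len (t * w) < len w ->
  exists2 i, i < size W & t * w = \prod_(s <- take i W ++ drop i.+1 W) s.
Proof.
move=> Rt Gw [WS def_w] lt_len; have [Gt tK [x ne_x] _] := Rt.
have [|noflip] := boolP (flips w x (t x)).
  by rewrite def_w; apply: exchange.
have [V [VS def_V] szV] := reduced_word (groupM Gt Gw).
have [|i lt_i def_i] := exchange VS Rt ne_x.
  rewrite -def_V /flips !permM tK; move: noflip; rewrite /flips.
  by have := perm_v_eq w x (t x); rewrite v_eq in ne_x; lia.
have def_w' : w = \prod_(s <- take i V ++ drop i.+1 V) s.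
  by rewrite -def_i -def_V; apply/permP=> y; rewrite !permM tK.
have VS' : {subset take i V ++ drop i.+1 V <= S}.
  by move=> s /(mem_subseq (subseq_omit i V)); apply: VS.
have := leq_ltn_trans (len_le (conj VS' def_w')) (size_omit lt_i).
by rewrite szV ltnNge (ltnW lt_len).
Qed.

Lemma bruhat_le_subword u w W : w \in G -> word_of w W -> bruhat_le G S u w ->
  exists2 V, subseq V W & word_of u V.
Proof.
move=> Gw [WS def_w] /connectP[p]; elim: p u => [|z p IHp] u /=.
  by move=> _ <-; exists W.
case/andP=> /andP[/exists_inP[t Rt /eqP def_z] lt_len] u_p def_last.
have [V sVW [VS defV]] := IHp z u_p def_last.
have Rt' := reflectionsP Rt; have [Gt tK _ _] := Rt'.
have Gz : z \in G by rewrite defV prod_in_G.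
have ut : u = z * t.
  by rewrite def_z; apply/permP=> x; rewrite !permM tK.
(* Bruhat steps multiply on the right; conjugating by [z^-1] moves the reflection to the left, where
   [strong_exchange] applies. *)
have Rt1 : reflection (t ^ z^-1) by apply: reflectionJ; rewrite ?groupV.
have def_u : u = t ^ z^-1 * z by rewrite conjgE invgK ut -!mulgA mulVg mulg1.
rewrite def_u in lt_len.
have [i lt_i def_i] := strong_exchange Rt1 Gz (conj VS defV) lt_len.
have sub_i := subseq_omit i V.
exists (take i V ++ drop i.+1 V); first exact: subseq_trans sub_i sVW.
by split=> [s /(mem_subseq sub_i)/VS|] //; rewrite def_u.
Qed.

Lemma reflections_conj s g : s \in S -> g \in G -> s ^ g \in reflections G S.
Proof. by move=> Ss Gg; apply/imset2P; exists s g. Qed.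

(** Omitting [s] is right multiplication by the conjugate of [s] by the product of [B]. *)
Lemma bruhat_step_omit A s B :
    {subset A ++ s :: B <= S} ->
    len (\prod_(x <- A ++ B) x) < len (\prod_(x <- A ++ s :: B) x) ->
  bruhat_step G S (\prod_(x <- A ++ B) x) (\prod_(x <- A ++ s :: B) x).
Proof.
move=> WS lt_len; rewrite /bruhat_step lt_len andbT.
have Ss : s \in S by apply: WS; rewrite mem_cat mem_head orbT.
have GB : \prod_(x <- B) x \in G.
  by apply: prod_in_G => x Bx; apply: WS; rewrite mem_cat inE Bx !orbT.
apply/exists_inP; exists (s ^ \prod_(x <- B) x); first exact: reflections_conj.
by rewrite !big_cat big_cons conjgE -!mulgA mulKVg.
Qed.

Lemma reduced_prefix W k : {subset W <= S} -> len (\prod_(x <- W) x) = size W ->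
  k <= size W ->
  len (\prod_(x <- take k W) x) = k /\
  bruhat_le G S (\prod_(x <- take k W) x) (\prod_(x <- W) x).
Proof.
elim/last_ind: W => [|W s IHW]; first by case: k => // _ ? _; split=> //; apply: connect0.
move=> WS lenW; have WS' : {subset W <= S}.
  by move=> x Wx; apply: WS; rewrite mem_rcons inE Wx orbT.
(* A shorter word [V] for the prefix, followed by [s], would shorten the whole word. *)
have lenW' : len (\prod_(x <- W) x) = size W.
  have [V [VS def_V] szV] := reduced_word (prod_in_G WS').
  have := @len_le _ _ (conj WS' erefl).
  have := @len_le (\prod_(x <- rcons W s) x) (rcons V s).
  rewrite lenW !size_rcons szV => lenV.
  suff : size W < (len (\prod_(x <- W) x)).+1 by lia.
  apply: lenV; split; last by rewrite -!cats1 !big_cat /= -def_V.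
  move=> x; rewrite mem_rcons inE => /predU1P[->|/VS//].
  by apply: WS; rewrite mem_rcons mem_head.
rewrite size_rcons leq_eqVlt => /predU1P[->|lt_k].
  by rewrite -(size_rcons W s) take_size lenW; split=> //; apply: connect0.
rewrite -cats1 takel_cat //; have [|lenk lek] := IHW WS' lenW'; first by lia.
split=> //; apply: connect_trans lek (connect1 _).
rewrite -{1}[W]cats0; apply: bruhat_step_omit; rewrite ?cats0 cats1 //.
by rewrite lenW lenW' size_rcons.
Qed.

(** * Cuts of the chain *)

(** Only upward crossings are recorded: by finiteness, a permutation with none has no downward ones
    either ([perm_stable_lower]). *)
Definition crosses (w : {perm T}) (c : int) :=
  [exists y, (v y <= c)%R && (c < v (w y))%R].

Lemma crossesP (w : {perm T}) c :
  reflect (exists y, (v y <= c)%R /\ (c < v (w y))%R) (crosses w c).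
Proof. by apply: (iffP existsP) => -[y] => [/andP|] ycw; exists y => //; apply/andP. Qed.

Lemma gen_cross s c y : s \in S -> (v y <= c)%R -> (c < v (s y))%R ->
  v y = c /\ v (s y) = (c + 1)%R.
Proof. by move=> /S_step => /(_ y); lia. Qed.

Lemma crossing_gen_eq s t c : s \in S -> t \in S -> crosses s c -> crosses t c -> s = t.
Proof.
move=> Ss St /crossesP[y [le_y lt_y]] /crossesP[z [le_z lt_z]].
have [vy vsy] := gen_cross Ss le_y lt_y; have [vz vtz] := gen_cross St le_z lt_z.
have yz : z = y by apply: v_inj; rewrite vy vz.
apply: (gen_eq (x := y)) => //; first by rewrite v_eq vsy vy; lia.
by rewrite -{1}yz; apply: v_inj; rewrite vsy vtz.
Qed.

Lemma uncrossed_word W c y : {subset W <= S} ->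
    (forall s, s \in W -> ~~ crosses s c) ->
  (v ((\prod_(s <- W) s)%g y) <= c)%R = (v y <= c)%R.
Proof.
elim: W y => [|s W IHW] y WS noW; first by rewrite big_nil perm1.
rewrite big_cons permM IHW; first last.
- by move=> t tW; apply: noW; rewrite inE tW orbT.
- by move=> t tW; apply: WS; rewrite inE tW orbT.
have Ss : s \in S by apply: WS; rewrite mem_head.
have no_s z : (v z <= c)%R -> (v (s z) <= c)%R.
  move=> le_z; have : ~~ crosses s c by apply: noW; rewrite mem_head.
  by rewrite leNgt; apply: contra => lt_z; apply/crossesP; exists z.
by apply/idP/idP => [/no_s|/no_s//]; rewrite S_inv.
Qed.

Lemma crosses_letter W c : {subset W <= S} -> crosses (\prod_(s <- W) s) c ->
  exists2 s, s \in W & crosses s c.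
Proof.
move=> WS /crossesP[y [le_y lt_y]].
apply/(@hasP _ (crosses^~ c)); apply: contraLR lt_y.
rewrite -all_predC => /allP noW; rewrite -leNgt uncrossed_word //.
Qed.

Lemma uncrossed_letters s (W : seq {perm T}) c : {subset W <= S} -> s \in S -> crosses s c ->
  s \notin W -> forall t, t \in W -> ~~ crosses t c.
Proof.
move=> WS Ss cr_s sW t tW; apply: contra sW => cr_t.
by rewrite (crossing_gen_eq Ss (WS t tW) cr_s cr_t).
Qed.

(** The other letters differ from [s], so they preserve both sides of the cut and never undo its
    crossing. *)
Lemma letter_crosses W s c : {subset W <= S} -> uniq W -> s \in W ->
  crosses s c -> crosses (\prod_(x <- W) x) c.
Proof.
move=> WS uW sW cr_s; case/splitPr: sW WS uW => A B WS.
rewrite cat_uniq /= negb_or => /and3P[_ /andP[sA _] /andP[sB _]].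
have Ss : s \in S by apply: WS; rewrite mem_cat mem_head orbT.
have AS : {subset A <= S} by move=> x xA; apply: WS; rewrite mem_cat xA.
have BS : {subset B <= S} by move=> x xB; apply: WS; rewrite mem_cat inE xB !orbT.
have [y [le_y lt_y]] := crossesP _ _ cr_s.
apply/crossesP; exists ((\prod_(x <- A) x)^-1 y).
rewrite big_cat big_cons !permM permKV.
have noA := uncrossed_letters AS Ss cr_s sA.
have noB := uncrossed_letters BS Ss cr_s sB.
rewrite -(uncrossed_word _ AS noA) permKV; split=> //.
by rewrite ltNge uncrossed_word // -ltNge.
Qed.

(** * Supports and subwords *)

(** Read off from the crossed cuts, hence independent of any word: these letters occur in every word
    for [w], and they are all the letters of a word without repetition. *)
Definition support (w : {perm T}) : {set {perm T}} :=
  [set s in S | [exists x, (v x < v (s x))%R && crosses w (v x)]].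

Lemma support_sub w W : word_of w W -> {subset support w <= W}.
Proof.
case=> WS -> s; rewrite inE => /andP[Ss /existsP[x /andP[lt_x cr_w]]].
have [t tW cr_t] := crosses_letter WS cr_w.
rewrite (crossing_gen_eq Ss (WS t tW) _ cr_t) //.
by apply/crossesP; exists x.
Qed.

Lemma support_uniq w W : word_of w W -> uniq W -> support w =i W.
Proof.
move=> wW uW s; apply/idP/idP; first exact: support_sub.
case: wW => WS -> sW; have Ss := WS s sW; rewrite inE Ss /=.
have [x lt_x] := gen_moves_up Ss; apply/existsP; exists x; rewrite lt_x /=.
by apply: (letter_crosses WS uW sW); apply/crossesP; exists x.
Qed.

(** Every word for [w] contains its support, which consists of the [size W] letters of [W]. *)
Lemma uniq_word_reduced w W : word_of w W -> uniq W -> len w = size W.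
Proof.
move=> wW uW; apply/eqP; rewrite eqn_leq (len_le wW) /=.
have Gw : w \in G by case: wW => WS ->; apply: prod_in_G.
have [V wV <-] := reduced_word Gw.
by apply: uniq_leq_size => // s; rewrite -(support_uniq wW uW); apply: support_sub.
Qed.

(** Letters are omitted one at a time; all intermediate words have distinct letters and so are
    reduced, which makes each omission a Bruhat step. *)
Lemma subword_le W V : {subset W <= S} -> uniq W -> subseq V W ->
  bruhat_le G S (\prod_(x <- V) x) (\prod_(x <- W) x).
Proof.
have [d] := ubnP (size W); elim: d W => // d IHd W le_d WS uW sVW.
have uV := subseq_uniq sVW uW.
have [allV|/allPn[s sW sV]] := boolP (all (mem V) W).
  have -> : V = W; last exact: connect0.
  by rewrite ((subseq_uniqP uW sVW)); apply/all_filterP.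
case/splitPr: sW WS uW sVW le_d => A B WS uW sVW le_d.
have {}sV : s \notin V by [].
have sABW : subseq (A ++ B) (A ++ s :: B) by rewrite subseq_cat2l subseq_cons.
have ABS : {subset A ++ B <= S} by move=> x /(mem_subseq sABW)/WS.
have uAB := subseq_uniq sABW uW.
have sVAB : subseq V (A ++ B).
  apply/subseq_uniqP => //.
  by rewrite {1}((subseq_uniqP uW sVW)) !filter_cat /= (negPf sV).
apply: connect_trans (IHd (A ++ B) _ ABS uAB sVAB) (connect1 _).
  by move: le_d; rewrite !size_cat /=; lia.
apply: bruhat_step_omit => //.
rewrite (uniq_word_reduced (conj ABS erefl) uAB).
by rewrite (uniq_word_reduced (conj WS erefl) uW) !size_cat /= addnS.
Qed.

Lemma ideal_subword w W u : word_of w W -> u \in principal_ideal G S w ->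
  exists2 V, subseq V W & word_of u V.
Proof.
move=> wW; rewrite inE => /andP[_]; apply: bruhat_le_subword => //.
by case: wW => WS ->; apply: prod_in_G.
Qed.

Lemma subword_ideal w W V : word_of w W -> uniq W -> subseq V W ->
  \prod_(s <- V) s \in principal_ideal G S w.
Proof.
case=> WS -> uW sVW; rewrite inE subword_le // andbT.
by apply: prod_in_G => s /(mem_subseq sVW)/WS.
Qed.

Lemma ideal_uniq_le w W u1 u2 : word_of w W -> uniq W ->
    u1 \in principal_ideal G S w -> u2 \in principal_ideal G S w ->
  bruhat_le G S u1 u2 = (support u1 \subset support u2).
Proof.
move=> wW uW Iu1 Iu2.
have [V1 sV1 wV1] := ideal_subword wW Iu1; have [V2 sV2 wV2] := ideal_subword wW Iu2.
have uV1 := subseq_uniq sV1 uW; have uV2 := subseq_uniq sV2 uW.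
have Gu2 : u2 \in G by case: wV2 => V2S ->; apply: prod_in_G.
apply/idP/subsetP=> [le_u s /(support_sub wV1)|sub12].
  rewrite (support_uniq wV2) // => sV.
  have [V sVV2 wV] := bruhat_le_subword Gu2 wV2 le_u.
  by apply: (mem_subseq sVV2); apply: (support_sub wV); rewrite (support_uniq wV1).
have sub_V s : s \in V1 -> s \in V2.
  by rewrite -(support_uniq wV1) // -(support_uniq wV2) //; apply: sub12.
have [[V1S ->] [V2S ->]] := (wV1, wV2); apply: subword_le => //.
(* Both subwords are filters of the same [W], so inclusion of letter sets gives a subsequence. *)
apply/subseq_uniqP => //; rewrite {1}((subseq_uniqP uW sV2)) -filter_predI.
rewrite {1}((subseq_uniqP uW sV1)); apply: eq_filter => s /=.
by apply/idP/andP=> [sV|[]//]; rewrite sub_V.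
Qed.

(** * Boolean ideals and words without repetition *)

Lemma uniq_word_boolean w W : word_of w W -> uniq W -> boolean G S w.
Proof.
move=> wW uW; exists (size W).
(* The rank is [size W], and an element of the ideal is encoded by the positions in [W] of its
   support. *)
pose f u := [set i : 'I_(size W) | nth 1 W i \in support u].
have in_f u i : (i \in f u) = (nth 1 W i \in support u) by rewrite inE.
have fP u1 u2 : u1 \in principal_ideal G S w ->
    (f u1 \subset f u2) = (support u1 \subset support u2).
  move=> Iu1; apply/subsetP/subsetP=> [sub12 s su1 | sub12 i].
    have [V1 sV1 wV1] := ideal_subword wW Iu1.
    have sW : s \in W by apply: (mem_subseq sV1); apply: (support_sub wV1).
    rewrite -(nth_index 1 sW); have lt_s : index s W < size W by rewrite index_mem.
    by have := sub12 (Ordinal lt_s); rewrite !in_f /= nth_index // => /(_ su1).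
  by rewrite !in_f; apply: sub12.
exists f; split.
- move=> u1 u2 Iu1 Iu2 eq_f.
  have [V1 sV1 wV1] := ideal_subword wW Iu1; have [V2 sV2 wV2] := ideal_subword wW Iu2.
  have eq_V : V1 = V2.
    rewrite (subseq_uniqP uW sV1) (subseq_uniqP uW sV2).
    apply: eq_filter => s; rewrite -(support_uniq wV1) -?(support_uniq wV2) ?(subseq_uniq _ uW) //.
    apply/idP/idP; apply/subsetP; rewrite -fP ?eq_f //.
  by case: wV1 wV2 => _ -> [_ ->]; rewrite eq_V.
- apply/eqP; rewrite eqEsubset subsetT /=; apply/subsetP=> A _.
  pose V := [seq s <- W | [exists i in A, nth 1 W i == s]].
  have sVW : subseq V W by apply: filter_subseq.
  have VS : {subset V <= S} by move=> s /(mem_subseq sVW); case: wW => WS _ /WS.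
  apply/imsetP; exists (\prod_(s <- V) s); first exact: subword_ideal wW uW sVW.
  apply/setP=> i; rewrite in_f (support_uniq (conj VS erefl)) ?filter_uniq //.
  rewrite mem_filter mem_nth // andbT; apply/idP/exists_inP=> [iA | [j jA]].
    by exists i.
  by rewrite nth_uniq // => /eqP/val_inj <-.
by move=> u1 u2 Iu1 Iu2; rewrite fP // (ideal_uniq_le wW uW).
Qed.

Lemma boolean_uniq_word w : w \in G -> boolean G S w ->
  exists2 W, word_of w W & uniq W.
Proof.
move=> Gw [r [f [f_inj f_onto f_le]]]; have [W wW szW] := reduced_word Gw.
exists W => //; have [WS def_w] := wW.
have inI u : u \in G -> bruhat_le G S u w -> u \in principal_ideal G S w.
  by move=> Gu le_u; rewrite inE Gu.
pose p k := \prod_(x <- take k W) x.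
have pP k : k <= size W -> [/\ p k \in principal_ideal G S w, len (p k) = k
    & forall j, j <= k -> bruhat_le G S (p j) (p k)].
  move=> le_k; have [|lenp le_p] := reduced_prefix WS _ le_k; first by rewrite -def_w.
  have kWS : {subset take k W <= S} by move=> s /mem_take/WS.
  split=> // [|j le_jk]; first by apply: inI; [apply: prod_in_G | rewrite def_w].
  have := @reduced_prefix (take k W) j kWS; rewrite size_takel // => /(_ lenp le_jk)[_].
  by rewrite take_takel.
(* The prefixes strictly increase in the ideal, so their images gain at least one element each
   time. *)
have card_p k : k <= size W -> k <= #|f (p k)|.
  elim: k => // k IHk lt_k; apply: leq_ltn_trans (IHk (ltnW lt_k)) _.
  have [Ik lenk _] := pP k (ltnW lt_k); have [Ik1 lenk1 le_k] := pP _ lt_k.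
  apply: proper_card; rewrite properEneq -f_le // le_k // andbT.
  by apply/eqP=> /(f_inj _ _ Ik Ik1) eq_p; move: lenk lenk1; rewrite eq_p; lia.
have le_r : size W <= r.
  by apply: leq_trans (card_p _ (leqnn _)) _; rewrite -[r in _ <= r]card_ord max_card.
have f_surj A : exists2 u, u \in principal_ideal G S w & f u = A.
  have : A \in f @: principal_ideal G S w by rewrite f_onto inE.
  by case/imsetP=> u Iu ->; exists u.
have [I1 _ _] := pP 0 (leq0n _); rewrite /p take0 big_nil in I1.
have f1 : f 1 = set0.
  have [u0 Iu0 f_u0] := f_surj set0.
  apply/eqP; rewrite -subset0 -f_u0 -f_le //.
  have [Gu0 _] := setIdP Iu0; have [U [US def_u] szU] := reduced_word Gu0.
  have := @reduced_prefix U 0 US; rewrite take0 big_nil -def_u.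
  by case=> //; rewrite szU.
(* The first letter [s] of a reduced word of the atom lies below it and is not the identity, so it
   is the atom. *)
have atom i : exists2 s, s \in W & f s = [set i].
  have [u Iu f_u] := f_surj [set i]; have [Gu le_u] := setIdP Iu.
  have [[|s U] [US def_u] szU] := reduced_word Gu.
    by move: f_u; rewrite def_u big_nil f1 => /setP/(_ i); rewrite !inE eqxx.
  have Ss : s \in S by apply: US; rewrite mem_head.
  have sW1 : word_of s [:: s].
    by split=> [x|]; [rewrite inE => /eqP-> | rewrite big_seq1].
  have [||_] := @reduced_prefix (s :: U) 1 US; rewrite -?def_u //= take0 big_seq1 => le_su.
  have le_sw := connect_trans le_su le_u.
  have Is := inI s (gen_in_G Ss) le_sw.
  have [V sVW sV] := bruhat_le_subword Gw wW le_sw.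
  exists s; first by apply: (mem_subseq sVW); apply: (support_sub sV);
    rewrite (support_uniq sW1) ?mem_head.
  have := f_le _ _ Is Iu; rewrite le_su f_u subset1 => /esym/orP[/eqP//|/eqP].
  rewrite -f1 => /(f_inj _ _ Is I1) s1; have := uniq_word_reduced sW1 isT.
  have W1 : word_of 1 [::] by split; rewrite ?big_nil.
  by have := uniq_word_reduced W1 isT; rewrite s1 => ->.
(* The [r] singletons are images of letters, so [W] has at least [r] distinct letters, while its
   size is at most [r]. *)
have : r <= size (map f (undup W)).
  rewrite -[r in r <= _]size_enum_ord -(size_map (@set1 _)).
  apply: uniq_leq_size; first by rewrite map_inj_uniq ?enum_uniq //; apply: set1_inj.
  move=> _ /mapP[i _ ->]; have [s sW <-] := atom i.
  by apply: map_f; rewrite mem_undup.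
rewrite size_map => le_r2; apply: contraT.
by rewrite -ltn_size_undup ltnNge (leq_trans le_r le_r2).
Qed.

(** * Pattern avoidance and distinct letters *)

Definition avoids321 (w : {perm T}) := forall a b c,
  (v a < v b)%R -> (v b < v c)%R -> (v (w b) < v (w a))%R -> (v (w c) < v (w b))%R -> False.

Definition avoids3412 (w : {perm T}) := forall a b c d,
  (v a < v b)%R -> (v b < v c)%R -> (v c < v d)%R ->
  (v (w c) < v (w d))%R -> (v (w d) < v (w a))%R -> (v (w a) < v (w b))%R -> False.

(** A single letter of [W] crosses the cut, and it carries only the element at [c] across; the
    letters around it preserve both sides. *)
Lemma uniq_word_crossing w W c y z : word_of w W -> uniq W ->
    (v y <= c)%R -> (c < v (w y))%R -> (v z <= c)%R -> (c < v (w z))%R -> y = z.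
Proof.
move=> [WS ->] uW le_y lt_y le_z lt_z.
have [|s sW cr_s] := @crosses_letter W c WS; first by apply/crossesP; exists y.
case/splitPr: sW WS uW le_y lt_y le_z lt_z => A B WS.
rewrite cat_uniq /= negb_or => /and3P[_ /andP[sA _] /andP[sB _]].
have Ss : s \in S by apply: WS; rewrite mem_cat mem_head orbT.
have AS : {subset A <= S} by move=> x xA; apply: WS; rewrite mem_cat xA.
have BS : {subset B <= S} by move=> x xB; apply: WS; rewrite mem_cat inE xB !orbT.
have noA := uncrossed_letters AS Ss cr_s sA.
have noB := uncrossed_letters BS Ss cr_s sB.
rewrite big_cat big_cons !permM -(uncrossed_word y AS noA) -(uncrossed_word z AS noA) => le_y.
rewrite !ltNge !(uncrossed_word _ BS noB) -!ltNge => lt_y le_z lt_z.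
apply: (@perm_inj _ (\prod_(x <- A) x)); apply: v_inj.
by rewrite (gen_cross Ss le_y lt_y).1 (gen_cross Ss le_z lt_z).1.
Qed.

Lemma perm_stable_lower (w : {perm T}) c :
  (forall y, (v y <= c)%R -> (v (w y) <= c)%R) ->
  forall y, (v (w y) <= c)%R = (v y <= c)%R.
Proof.
move=> w_low y; apply/idP/idP; last exact: w_low.
pose C := [set y | (v y <= c)%R].
have wC : w @: C = C.
  apply/eqP; rewrite eqEcard card_imset ?leqnn ?andbT; last exact: perm_inj.
  by apply/subsetP=> _ /imsetP[z + ->]; rewrite !inE; apply: w_low.
move=> le_wy; have : w y \in w @: C by rewrite wC inE.
by rewrite (mem_imset _ _ (@perm_inj _ w)) inE.
Qed.

Lemma word_of_inv w W : word_of w W -> word_of w^-1 (rev W).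
Proof.
case=> WS ->; split=> [s|]; first by rewrite mem_rev; apply: WS.
elim: W WS => [|s W IHW] WS; first by rewrite !big_nil invg1.
rewrite rev_cons -cats1 big_cat big_seq1 big_cons invMg IHW => [|t tW]; last first.
  by apply: WS; rewrite inE tW orbT.
congr (_ * _); apply/permP=> x; apply: (@perm_inj _ s).
by rewrite permKV S_inv // WS ?mem_head.
Qed.

Lemma uniq_word_crossing_down w W c y z : word_of w W -> uniq W ->
  (v (w y) <= c)%R -> (c < v y)%R -> (v (w z) <= c)%R -> (c < v z)%R -> y = z.
Proof.
move=> /word_of_inv wW uW le_y lt_y le_z lt_z; apply: (@perm_inj _ w).
by apply: (uniq_word_crossing (c := c) wW); rewrite ?rev_uniq ?permK.
Qed.

(* The first letter moving [b] carries it across a cut that no other letter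
   crosses back. *)
Lemma moved_by_letter W s b : {subset W <= S} -> uniq W -> s \in W -> s b != b ->
  (\prod_(x <- W) x) b != b.
Proof.
elim: W => // t W IHW WS /= /andP[tW uW]; rewrite big_cons permM inE => sW sb.
have St : t \in S by apply: WS; rewrite mem_head.
have {}WS : {subset W <= S} by move=> x xW; apply: WS; rewrite inE xW orbT.
have [tb|] := eqVneq (t b) b.
  by rewrite tb; apply: IHW => //; case/predU1P: sW sb => // ->; rewrite tb eqxx.
rewrite v_eq => tb; have [lt_b|le_b] := boolP (v b < v (t b))%R.
  have cr_t : crosses t (v b) by apply/crossesP; exists b.
  apply/eqP=> eq_b; have := uncrossed_word (t b) WS (uncrossed_letters WS St cr_t tW).
  by rewrite eq_b; lia.
have cr_t : crosses t (v (t b)) by apply/crossesP; exists (t b); rewrite S_inv //; lia.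
apply/eqP=> eq_b; have := uncrossed_word (t b) WS (uncrossed_letters WS St cr_t tW).
by rewrite eq_b; lia.
Qed.

(** If [b] moves up, [a] and [b] both cross the cut at [b]; if it moves down, [b] and [c] both cross
    the cut at [w b] downwards. If [b] is fixed, [a] jumps over it, which needs a letter moving
    [b]. *)
Lemma uniq_word_avoids321 w W : word_of w W -> uniq W -> avoids321 w.
Proof.
move=> wW uW a b c lt_ab lt_bc lt_wba lt_wcb.
have [lt_b|ge_b] := boolP (v b < v (w b))%R.
  suff eq_ab : a = b by move: lt_ab; rewrite eq_ab; lia.
  by apply: (uniq_word_crossing (c := v b) wW uW); lia.
have [gt_b|le_b] := boolP (v (w b) < v b)%R.
  suff eq_bc : b = c by move: lt_bc; rewrite eq_bc; lia.
  by apply: (uniq_word_crossing_down (c := v (w b)) wW uW); lia.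
have wb : w b = b by apply: v_inj; lia.
have [WS def_w] := wW.
have [|s sW /crossesP[y [le_y lt_y]]] := @crosses_letter W (v b) WS.
  by rewrite -def_w; apply/crossesP; exists a; rewrite wb in lt_wba; lia.
have [vy vsy] := gen_cross (WS s sW) le_y lt_y.
have := moved_by_letter WS uW sW (b := b); rewrite -def_w wb eqxx.
by rewrite -(v_inj vy) v_eq; lia.
Qed.

(** At the cut just above [b], either [a] and [b] both cross upwards, or [c] and [d] both cross
    downwards. *)
Lemma uniq_word_avoids3412 w W : word_of w W -> uniq W -> avoids3412 w.
Proof.
move=> wW uW a b c d lt_ab lt_bc lt_cd lt_wcd lt_wda lt_wab.
have [lt_a|le_a] := boolP (v b < v (w a))%R.
  suff eq_ab : a = b by move: lt_ab; rewrite eq_ab; lia.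
  by apply: (uniq_word_crossing (c := v b) wW uW); lia.
suff eq_cd : c = d by move: lt_cd; rewrite eq_cd; lia.
by apply: (uniq_word_crossing_down (c := v b) wW uW); lia.
Qed.

(* If [s] is a descent of [w], an element crossing the cut between the swapped
   positions after the swap would complete them to a 321 or a 3412. *)
Lemma descent_cut s w p y : s \in S -> avoids321 w -> avoids3412 w ->
    (v p < v (s p))%R -> (v (w (s p)) < v (w p))%R ->
  (v ((s * w)%g y) <= v p)%R = (v y <= v p)%R.
Proof.
move=> Ss av3 av4 lt_p lt_wp; apply: perm_stable_lower y => y le_y.
rewrite leNgt; apply/negP=> lt_wy.
(* By finiteness, the upward crossing by [y] is matched by a downward crossing by some [z]. *)
have [/existsP[z /andP[lt_z le_wz]]|no_z] :=
  boolP [exists z, (v p < v z)%R && (v ((s * w)%g z) <= v p)%R]; last first.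
  have low x : (v x <= v p)%R -> (v ((s * w)^-1%g x) <= v p)%R.
    move=> le_x; rewrite leNgt; apply: contra no_z => lt_x; apply/existsP.
    by exists ((s * w)^-1 x); rewrite lt_x permKV.
  by have := perm_stable_lower low ((s * w) y); rewrite permK; lia.
rewrite !permM in lt_wy le_wz.
have ne_y := S_step y Ss; have ne_z := S_step (s z) Ss; have step_p := S_step p Ss.
rewrite S_inv // in ne_z.
have eq_z := perm_v_eq s z p; have eq_y : (v (s y) == v p) = (v y == v (s p)).
  by rewrite -(perm_v_eq s) S_inv.
have [y1|ne_y1] := eqVneq (s y) (s p); have [z1|ne_z1] := eqVneq (s z) p.
- by rewrite y1 in lt_wy; rewrite z1 in le_wz; lia.
- apply: (av3 p (s p) (s z)); rewrite v_eq in ne_z1; rewrite y1 in lt_wy; lia.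
- apply: (av3 (s y) p (s p)); rewrite v_eq in ne_y1; rewrite z1 in le_wz; lia.
(* Now [s y] lies below [p] and [s z] above [s p]. The 3412 arises when [w p] is above [w (s y)] and
   [w (s p)] below [w (s z)]; otherwise three of the four positions form a 321. *)
have := perm_v_eq w (s y) p; have := perm_v_eq w (s z) (s p).
rewrite !v_eq in ne_y1 ne_z1 => eq_wz eq_wy.
have [lt_wyp|le_wyp] := boolP (v (w p) < v (w (s y)))%R.
  by apply: (av3 (s y) p (s p)); lia.
have [lt_wzp|le_wzp] := boolP (v (w (s z)) < v (w (s p)))%R.
  by apply: (av3 p (s p) (s z)); lia.
by apply: (av4 (s y) p (s p) (s z)); lia.
Qed.

(** By [descent_cut], no inversion of [s * w] spans a pair swapped by [s]. Hence [s] keeps the order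
    of the positions of a pattern in [s * w] and carries it to one in [w]. *)
Lemma avoids_descent s w p : s \in S -> w \in G -> avoids321 w -> avoids3412 w ->
    (v p < v (s p))%R -> (v (w (s p)) < v (w p))%R ->
  avoids321 (s * w) /\ avoids3412 (s * w).
Proof.
move=> Ss Gw av3 av4 lt_p lt_wp.
have cut x y z : (v x < v (s x))%R -> (v y <= v x)%R -> (v x < v z)%R ->
    (v ((s * w)%g y) < v ((s * w)%g z))%R.
  move=> lt_x le_yx lt_xz; have lt_wx := gen_flips_all Ss Gw lt_p lt_wp lt_x.
  have := descent_cut y Ss av3 av4 lt_x lt_wx.
  have := descent_cut z Ss av3 av4 lt_x lt_wx.
  by rewrite le_yx => le_wz le_wy; lia.
have mono x y z t : (v x < v y)%R -> (v z <= v x)%R -> (v y <= v t)%R ->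
    (v ((s * w)%g t) < v ((s * w)%g z))%R -> (v (s x) < v (s y))%R.
  move=> lt_xy le_zx le_yt lt_w; apply: gen_lt => //.
  apply/eqP=> def_y; have lt_x : (v x < v (s x))%R by rewrite -def_y.
  by have := cut x z t lt_x le_zx; lia.
split=> [a b c lt_ab lt_bc lt_wba lt_wcb | a b c d lt_ab lt_bc lt_cd lt_wcd lt_wda lt_wab].
  have lt_sab := mono a b a b lt_ab (lexx _) (lexx _) lt_wba.
  have lt_sbc := mono b c b c lt_bc (lexx _) (lexx _) lt_wcb.
  by rewrite !permM in lt_wba lt_wcb; apply: (av3 (s a) (s b) (s c)).
(* The inversion formed by [a] and [d] spans all three consecutive pairs. *)
have lt_sab : (v (s a) < v (s b))%R by apply: (mono a b a d); lia.
have lt_sbc : (v (s b) < v (s c))%R by apply: (mono b c a d); lia.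
have lt_scd : (v (s c) < v (s d))%R by apply: (mono c d a d); lia.
by rewrite !permM in lt_wcd lt_wda lt_wab; apply: (av4 (s a) (s b) (s c) (s d)).
Qed.

Lemma avoids_uniq_word w : w \in G -> avoids321 w -> avoids3412 w ->
  exists2 W, word_of w W & uniq W.
Proof.
have [d] := ubnP #|inversions w|; elim: d w => // d IHd w le_d Gw av3 av4.
have [->|/exists_descent[s [p [Ss lt_p lt_wp]]]] := eqVneq w 1.
  by exists [::] => //; split; rewrite ?big_nil.
have [av3' av4'] := avoids_descent Ss Gw av3 av4 lt_p lt_wp.
have [||||W [WS def_w] uW] := IHd (s * w) => //.
- by have := inversions_gen Ss Gw lt_p lt_wp; lia.
- by rewrite groupM // gen_in_G.
exists (s :: W); first split.
- by move=> t; rewrite inE => /predU1P[->|/WS].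
- by rewrite big_cons -def_w gen_mulK.
(* If [s] occurred in [W], then [s * w] would cross the cut at [p], against [descent_cut]. *)
rewrite /= uW andbT; apply/negP=> sW.
have cr_s : crosses s (v p) by apply/crossesP; exists p.
have := letter_crosses WS uW sW cr_s; rewrite -def_w => /crossesP[y [le_y]].
by rewrite ltNge (descent_cut y Ss av3 av4 lt_p lt_wp) le_y.
Qed.

Lemma boolean_avoids w : w \in G -> boolean G S w <-> avoids321 w /\ avoids3412 w.
Proof.
move=> Gw; split=> [/(boolean_uniq_word Gw)[W wW uW] | [av3 av4]].
  by split; [apply: uniq_word_avoids321 wW uW | apply: uniq_word_avoids3412 wW uW].
by have [W wW uW] := avoids_uniq_word Gw av3 av4; apply: uniq_word_boolean wW uW.
Qed.

End AdjacentSwaps.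

(** * Specialization to types A and B *)

Definition pattern_occurs k (p : 'S_k) (T : finType) (v : T -> int) (w : {perm T}) :=
  exists2 i : 'I_k -> T,
    forall a b : 'I_k, a < b -> (v (i a) < v (i b))%R
  & forall a b : 'I_k, (v (w (i a)) < v (w (i b)))%R = (p a < p b).

Lemma p321E (i : 'I_3) : p321 i = 2 - i :> nat.
Proof. by case: i => [[|[|[|]]] lt_i] //; rewrite permE. Qed.

Lemma p3412E (i : 'I_4) : p3412 i = (if i < 2 then i + 2 else i - 2) :> nat.
Proof. by case: i => [[|[|[|[|]]]] lt_i] //; rewrite permM !permE. Qed.

Lemma avoids321P (T : finType) (v : T -> int) (w : {perm T}) :
  avoids321 v w <-> ~ pattern_occurs p321 v w.
Proof.
split=> [av [i lt_i w_i] | no a b c lt_ab lt_bc lt_wba lt_wcb].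
  pose o k : 'I_3 := inord k; have oE k : k < 3 -> o k = k :> nat by apply: inordK.
  by apply: (av (i (o 0)) (i (o 1)) (i (o 2))); rewrite ?lt_i ?w_i ?p321E ?oE.
apply: no; exists (fun k => nth a [:: a; b; c] k).
  by case=> [[|[|[|]]] //= ?] [[|[|[|]]] //= ?] _; lia.
by case=> [[|[|[|]]] //= ?] [[|[|[|]]] //= ?]; rewrite !p321E /=; lia.
Qed.

Lemma avoids3412P (T : finType) (v : T -> int) (w : {perm T}) :
  avoids3412 v w <-> ~ pattern_occurs p3412 v w.
Proof.
split=> [av [i lt_i w_i] | no a b c d lt_ab lt_bc lt_cd lt_wcd lt_wda lt_wab].
  pose o k : 'I_4 := inord k; have oE k : k < 4 -> o k = k :> nat by apply: inordK.
  by apply: (av (i (o 0)) (i (o 1)) (i (o 2)) (i (o 3)));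
    rewrite ?lt_i ?w_i ?p3412E ?oE.
apply: no; exists (fun k => nth a [:: a; b; c; d] k).
  by case=> [[|[|[|[|]]]] //= ?] [[|[|[|[|]]]] //= ?] _; lia.
by case=> [[|[|[|[|]]]] //= ?] [[|[|[|[|]]]] //= ?]; rewrite !p3412E /=; lia.
Qed.

Lemma booleanA_avoids n (w : 'S_n) :
  booleanA w <-> avoids p321 w /\ avoids p3412 w.
Proof.
pose v (i : 'I_n) := Posz i.
suff -> : booleanA w <-> avoids321 v w /\ avoids3412 v w.
  (* For this [v], occurrence in the chain is [contains] up to conversion. *)
  by rewrite avoids321P avoids3412P.
have gensAP s : s \in gensA n -> exists i j : 'I_n, i.+1 = j /\ s = tperm i j.
  by case/imset2P=> i j _; rewrite inE => /andP[_ /eqP ij] ->; exists i, j.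
apply: (@boolean_avoids 'I_n v id false [set: 'S_n]%G) => //.
- by move=> x y [] /val_inj.
- move=> x y lt_xy; have lt_z : x.+1 < n by apply: leq_trans (ltn_ord y); rewrite /v in lt_xy; lia.
  by exists (Ordinal lt_z); rewrite /v /=; lia.
- by move=> x y _; rewrite addbF.
- exact: subsetT.
- by move=> s x /gensAP[i [j [_ ->]]]; rewrite tpermK.
- by move=> s x /gensAP[i [j [ij ->]]]; case: tpermP => [->|->|]; rewrite /v; lia.
- move=> s x y /gensAP[i [j [_ ->]]]; rewrite !inE.
  case: (tpermP i j x) => [->|->|]; rewrite ?eqxx //;
    by case: (tpermP i j y) => [->|->|]; rewrite ?eqxx ?orbT.
- by move=> s /gensAP[i [j [ij ->]]]; exists i; rewrite tpermL -val_eqE /= -ij; lia.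
- move=> x y xy; exists (tperm x y); last by rewrite tpermL.
  by apply/imset2P; exists x y => //; rewrite inE /=; rewrite /v in xy; apply/eqP; lia.
Qed.

(* [pmval] skips 0; closing the gap makes adjacent positions differ by 1. *)
Definition pmrank n (x : pm n) : int := (if x.1 then - 1 - x.2%:Z else x.2%:Z)%R.

Lemma pmval_lt n (x y : pm n) : (pmval x < pmval y)%R = (pmrank x < pmrank y)%R.
Proof.
case: x y => [[] i] [[] j]; rewrite /pmval /pmrank /= ?expr0 ?expr1; lia.
Qed.

Lemma pmrank_inj n : injective (@pmrank n).
Proof.
move=> [[] i] [[] j]; rewrite /pmrank /= => eq_ij; try lia;
  by congr (_, _); apply: val_inj => /=; lia.
Qed.

Lemma pmrank_opp n (x : pm n) : pmrank (pmopp x) = (- 1 - pmrank x)%R.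
Proof. by case: x => [[] i]; rewrite /pmrank /=; lia. Qed.

Lemma gensBP n s : s \in gensB n ->
  (exists2 i : 'I_n, i = 0 :> nat &
     forall x, s x = (if x.2 == i then ~~ x.1 else x.1, x.2)) \/
  (exists i j : 'I_n, i.+1 = j /\ forall x, s x = (x.1, tperm i j x.2)).
Proof.
rewrite inE => /orP[/imsetP[i] | /imset2P[i j _]].
  rewrite inE => /eqP i0 ->; left; exists i => // -[b k]; rewrite permE /= !xpair_eqE.
  by case: b; case: (eqVneq k i) => [->|].
rewrite inE => /andP[_ /eqP ij] ->.
right; exists i, j; split=> // -[b k]; rewrite permM.
rewrite !permE /= !xpair_eqE; case: b => /=.
  by rewrite !xpair_eqE; case: (k == i); case: (k == j).
by case: (k == i); case: (k == j).
Qed.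

Lemma booleanB_avoids n (w : {perm (pm n)}) : w \in signed_perm n ->
  booleanB w <-> globally_avoids p321 w /\ globally_avoids p3412 w.
Proof.
move=> Bw; pose v := @pmrank n.
suff -> : booleanB w <-> avoids321 v w /\ avoids3412 v w.
  rewrite avoids321P avoids3412P /globally_avoids.
  have occ k (p : 'S_k) : globally_contains p w <-> pattern_occurs p v w.
    split=> -[i lt_i w_i]; exists i => a b.
    - by move/lt_i; rewrite pmval_lt.
    - by rewrite -w_i pmval_lt.
    - by move/lt_i; rewrite pmval_lt.
    - by rewrite -w_i pmval_lt.
  by rewrite !occ.
apply: (@boolean_avoids _ v (@pmopp n) true (signed_perm_group n)) => //.
- exact: pmrank_inj.
- move=> [[] k] [[] l]; rewrite /v /pmrank /= => lt_kl; try lia.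
  + have lt_z : k.-1 < n by have := ltn_ord k; lia.
    by exists (true, Ordinal lt_z) => /=; lia.
  (* The successor of -1 is 1, so index 0 changes sign instead of decreasing. *)
  + have [k0|k_gt0] := posnP k; first by exists (false, k) => /=; lia.
    have lt_z : k.-1 < n by have := ltn_ord k; lia.
    by exists (true, Ordinal lt_z) => /=; lia.
  + have lt_z : k.+1 < n by have := ltn_ord l; lia.
    by exists (false, Ordinal lt_z) => /=; lia.
- move=> x y; rewrite -(inj_eq (@pmrank_inj n)) /v !pmrank_opp; lia.
- by move=> u x; rewrite inE => /forallP/(_ x)/eqP.
- apply/subsetP=> s /gensBP s_def; rewrite inE; apply/forallP=> x; apply/eqP.
  case: s_def => [[i _ sE] | [i [j [_ sE]]]]; rewrite !sE /pmopp //=.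
  by case: ifP.
- move=> s x /gensBP[[i _ sE] | [i [j [_ sE]]]]; rewrite !sE /=.
    by case: x => b k /=; case: (k == i); rewrite ?negbK.
  by rewrite tpermK; case: x.
- move=> s [b k] /gensBP[[i i0 sE] | [i [j [ij sE]]]]; rewrite !sE /v /pmrank /=.
    by case: (eqVneq k i) => [->|_]; case: b => /=; lia.
  by case: tpermP => [->|->|_ _]; case: b; lia.
- move=> s [b k] [c l] /gensBP[[i i0 sE] | [i [j [ij sE]]]];
    rewrite !sE /pmopp /= !inE !xpair_eqE /=.
    by case: (eqVneq k i) => [->|_]; case: (eqVneq l i) => [->|_]; case: b c => [] [];
      rewrite ?eqxx ?orbT.
  case: (tpermP i j k) => [->|->|_ _]; case: (tpermP i j l) => [->|->|_ _];
    by case: b c => [] []; rewrite ?eqxx ?orbT.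
- move=> s /gensBP[[i _ sE] | [i [j [ij sE]]]].
    by exists (true, i); rewrite sE /= eqxx.
  by exists (true, i); rewrite sE /= tpermL xpair_eqE -val_eqE /= -ij; lia.
- have gen0 (i : 'I_n) : i = 0 :> nat -> tperm (false, i) (true, i) \in gensB n.
    by move=> i0; apply/setUP; left; apply/imsetP; exists i; rewrite ?inE ?i0.
  have gen (i j : 'I_n) : j = i.+1 :> nat ->
      (tperm (false, i) (false, j) * tperm (true, i) (true, j))%g \in gensB n.
    by move=> ij; apply/setUP; right; apply/imset2P; exists i j; rewrite ?inE //= -ij.
  (* Neighbours are both negative, with indices in reversed order, or -1 and 1, or both positive. *)
  move=> [[] k] [[] l]; rewrite /v /pmrank /= => kl; try lia.
  + eexists; first by apply: (gen l k); lia.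
    by rewrite permM (tpermD (z := (true, k))) ?tpermR.
  + have eq_kl : k = l by apply: val_inj => /=; lia.
    by eexists; [apply: (gen0 l); lia | rewrite eq_kl tpermR].
  + eexists; first by apply: (gen k l); lia.
    by rewrite permM tpermL tpermD.
Qed.


Theorem theorem5p5 :
  (forall (n : nat) (w : {perm (pm n)}),
     (0 < n)%N -> w \in signed_perm n ->
     (booleanB w <-> globally_avoids p321 w /\ globally_avoids p3412 w))
  /\ persistent boolean_patterns booleanA booleanB.
Proof.
split=> [n w _|]; first exact: booleanB_avoids.
split=> n w _; last move=> Bw.
  by rewrite booleanA_avoids; split=> [[av3 av4] k p []|av] //; split; apply: av; constructor.
by rewrite booleanB_avoids //; split=> [[av3 av4] k p []|av] //; split; apply: av; constructor.
Qed.
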